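(* Let $(X,d)$ be a complete metric space with $X$ nonempty, let $\varphi:[0,\infty[\to[0,\infty[$ be an altering function, put $e(x,y)=\varphi(d(x,y))$ for $x,y\in X$, and let $T:X\to X$ be a map. Let $\psi:[0,\infty[\to[0,\infty[$ be a function that is strictly subunitary on $]0,\infty[$ and right Boyd-Wong on $]0,\infty[$. Suppose that $T$ is $(d,e;M;\psi)$-contractive, i.e. $$e(Tx,Ty)\le \psi(d(x,y))\,M(x,y)\quad\text{for all } x,y\in X \text{ with } x\ne y.$$ Then $T$ is a globally strong Picard operator (modulo $d$).
   Context: A function $\varphi:[0,\infty[\to[0,\infty[$ is an altering function if it is continuous, increasing (in the wide sense: $s\le t$ implies $\varphi(s)\le\varphi(t)$), and satisfies $\varphi(t)=0$ if and only if $t=0$. For $x,y\in X$, define $M_1(x,y)=e(x,y)$, $M_2(x,y)=\tfrac12[e(x,Tx)+e(y,Ty)]$, $M_3(x,y)=\min\{e(x,Ty),e(Tx,y)\}$, $M(x,y)=\max\{M_1(x,y),M_2(x,y),M_3(x,y)\}$. The function $\psi$ is strictly subunitary on $]0,\infty[$ if $\psi(s)<1$ for all $s>0$. It is right Boyd-Wong on $]0,\infty[$ if $\limsup_{t\to s+}\psi(t)<1$ for all $s>0$, where $t\to s+$ means $t\to s$ with $t>s$. Write $\mathrm{Fix}(T)=\{x\in X: x=Tx\}$. The map $T$ is a strong Picard operator (modulo $d$) if for each $x\in X$ the sequence $(T^nx)_{n\ge0}$ converges with respect to $d$ and its limit belongs to $\mathrm{Fix}(T)$. It is a globally strong Picard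 operator (modulo $d$) if, in addition, $\mathrm{Fix}(T)$ has at most one element (hence exactly one). *)

(* Defs.v *)
From HB Require Import structures.
From mathcomp Require Import all_boot all_order all_algebra.
From mathcomp Require Import all_classical all_reals all_analysis.

Set Implicit Arguments.
Unset Strict Implicit.
Unset Printing Implicit Defensive.

Import Order.TTheory GRing.Theory Num.Theory.
Import numFieldNormedType.Exports.

Local Open Scope classical_set_scope.
Local Open Scope ring_scope.

(* Nonemptiness is part of the structure: [Complete] inherits from [Pointed]. *)
#[short(type="completeMetricType")]
HB.structure Definition CompleteMetric (R : numDomainType) :=
  { T of Complete T & Metric R T }.

(* Functions [0,oo[ -> [0,oo[ are represented by functions f : R -> R mapping
   [0,oo[ into itself; their values on negative reals are irrelevant. *)
Definition nneg_fun (R : realType) (f : R -> R) : Prop :=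
  set_fun `[0, +oo[ `[0, +oo[ f.

Definition altering (R : realType) (phi : R -> R) : Prop :=
  [/\ nneg_fun phi,
      {within `[0, +oo[, continuous phi},
      {in `[0, +oo[ &, {homo phi : s t / s <= t}} &
      forall t, 0 <= t -> (phi t = 0 <-> t = 0)].

Definition strictly_subunitary (R : realType) (psi : R -> R) : Prop :=
  forall s, 0 < s -> psi s < 1.

Definition right_Boyd_Wong (R : realType) (psi : R -> R) : Prop :=
  forall s : R, 0 < s -> (limf_esup (EFin \o psi) s^'+ < 1)%E.

Definition altered_dist (R : realType) (X : metricType R) (phi : R -> R)
  (x y : X) : R := phi (mdist x y).

Section Contractive.
Context {R : realType} {X : metricType R}.
Variables (e : X -> X -> R) (T : X -> X).

Definition M1 (x y : X) : R := e x y.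
Definition M2 (x y : X) : R := 2^-1 * (e x (T x) + e y (T y)).
Definition M3 (x y : X) : R := Num.min (e x (T y)) (e (T x) y).
Definition M (x y : X) : R := Num.max (Num.max (M1 x y) (M2 x y)) (M3 x y).

Definition contractive (psi : R -> R) : Prop :=
  forall x y : X, x <> y -> e (T x) (T y) <= psi (mdist x y) * M x y.

End Contractive.

Section Picard.
Context {R : realType} {X : completeMetricType R}.
Variable T : X -> X.

Definition Fix : set X := [set x | x = T x].

Definition strong_Picard : Prop :=
  forall x : X, let u := fun n : nat => iter n T x in cvgn u /\ Fix (limn u).

Definition globally_strong_Picard : Prop :=
  strong_Picard /\ is_subset1 Fix.

End Picard.

(* Main.v *)
Require Import Defs.
From mathcomp Require Import all_boot all_order all_algebra.
From mathcomp Require Import all_classical all_reals all_analysis.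
From mathcomp Require Import lra.

(** Write [e x y = phi (d x y)]; since [phi] is nondecreasing, a strict
    inequality between two values of [e] is one between the distances.

    The whole argument rests on one consequence of the right Boyd-Wong
    condition ([contractive_gap]).  Just to the right of a level [s > 0],
    [psi] is bounded by some [c < 1], and [phi] is continuous and positive at
    [s]; hence, for a small [eta], [psi t * phi (s + eta) < phi (s - eta)] for
    all [t] in [(s, s + eta)].  A pair at distance [t] in that interval, for
    which [M] is at most [phi (s + eta)], must therefore be sent to a pair at
    distance below [s - eta].  This is used twice.

    - Along an orbit [x_n], the distances [d x_n x_(n+1)] decrease, strictly
      until they vanish, because there [M] reduces to [e x_n x_(n+1)].  If their
      limit [s] were positive they would enter [(s, s + eta)], and the next one
      would drop below [s]: so they tend to [0] ([contractive_regular]).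
    - Two points moved very little by [T] cannot be at a distance just above
      [s], since their images are about as far apart as they are
      ([contractive_separation]).  From a late index [N] on, the distance from
      [x_N] to [x_n] starts at [0] and changes by tiny steps as [n] grows; it
      cannot jump over the forbidden interval, so it stays at most [s], and the
      orbit is Cauchy ([contractive_cvg]).

    At a limit [z] of the orbit, the terms [M1] and [M3] of [M x_n z] vanish
    asymptotically and [M2] tends to half of [e z (T z)], while
    [e x_(n+1) (T z)] tends to [e z (T z)]; this forces [e z (T z) = 0]
    ([contractive_limit_Fix]).  For two distinct fixed points, [M] reduces to
    [e x y], so contractivity with [psi < 1] is absurd. *)

Set Implicit Arguments.
Unset Strict Implicit.
Unset Printing Implicit Defensive.

Import Order.TTheory GRing.Theory Num.Theory.
Import numFieldNormedType.Exports.

Local Open Scope classical_set_scope.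
Local Open Scope ring_scope.

(** * Altering functions *)

Lemma nneg_fun_ge0 (R : realType) (f : R -> R) t :
  nneg_fun f -> 0 <= t -> 0 <= f t.
Proof. by move=> + t0 => /(_ t) /=; rewrite !in_itv /= !andbT; exact. Qed.

Section AlteringFunctions.
Context {R : realType} (phi : R -> R).
Context (phiA : altering phi).

Lemma altering_ge0 t : 0 <= t -> 0 <= phi t.
Proof. by case: phiA => phi_nneg _ _ _; exact: nneg_fun_ge0. Qed.

Lemma altering_le s t : 0 <= s -> s <= t -> phi s <= phi t.
Proof.
move=> s0 st; case: phiA => _ _ phi_homo _.
by apply: phi_homo; rewrite ?in_itv /= ?andbT // (le_trans s0).
Qed.

Lemma altering0 : phi 0 = 0.
Proof. by case: phiA => _ _ _ /(_ 0 (lexx _)) [_ ->]. Qed.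

Lemma altering_gt0 t : 0 < t -> 0 < phi t.
Proof.
move=> t0; rewrite lt_neqAle altering_ge0 ?ltW // andbT eq_sym.
apply/eqP => phit0; case: phiA => _ _ _ /(_ t (ltW t0)) [/(_ phit0) tE _].
by rewrite tE ltxx in t0.
Qed.

Lemma altering_continuous s k : 0 <= s -> 0 < k ->
  exists2 d, 0 < d & forall t, 0 <= t -> `|t - s| < d -> `|phi t - phi s| < k.
Proof.
move=> s0 k0; case: phiA => _ phi_cont _ _.
have /(_ s) := (subspace_continuousP _ _).1 phi_cont.
rewrite /= in_itv /= s0 => /(_ isT) /cvgrPdist_lt /(_ k k0).
rewrite near_withinE => /nbhs_ballP [d d0 dP]; exists d => // t t0 ts.
have := dP t; rewrite /ball /= distrC in_itv /= t0 => /(_ ts isT).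
by rewrite distrC.
Qed.

End AlteringFunctions.

(** * Consequences of the right Boyd-Wong condition *)

(** The infimum defining the limit superior is below [1], so some punctured
    right neighbourhood already has a supremum below [1]. *)
Lemma right_Boyd_Wong_near (R : realType) (psi : R -> R) s :
  right_Boyd_Wong psi -> 0 < s ->
  exists c d, [/\ 0 < c < 1, 0 < d & forall t, s < t < s + d -> psi t <= c].
Proof.
move=> psiBW /psiBW; rewrite limf_esupE.
move=> /ereal_inf_lt [_ [A sA <-]] supA_lt1.
have [c c01 cP] : exists2 c, 0 < c < 1 & forall t, A t -> psi t <= c.
  have supP t : A t -> ((psi t)%:E <= ereal_sup [set (EFin \o psi) x | x in A])%E.
    by move=> At; apply: ereal_sup_ubound; exists t.
  move: (ereal_sup _) supA_lt1 supP => [r| |] //=.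
    (* The maximum with 1/2 only serves to make the bound positive. *)
    rewrite lte_fin => r1 rP; exists (Num.max r (2^-1)).
      by rewrite lt_max gt_max r1 invr_gt0 invf_lt1 ?ltr0n ?ltr1n ?orbT.
    by move=> t /rP; rewrite lee_fin le_max => ->.
  move=> _ rP; exists 2^-1; first by rewrite invr_gt0 invf_lt1 ?ltr0n ?ltr1n.
  by move=> t /rP.
have /nbhs_ballP [d d0 dP] : nbhs s (fun t => s < t -> A t) by exact: sA.
exists c, d; split=> // t /andP[st tsd]; apply/cP/dP => //.
rewrite /ball /= ltr_distlC; lra.
Qed.

(** The inequality is strict at the level [s] itself, where it reads
    [c * phi s < phi s]; continuity of [phi] leaves room for a window of
    radius [eta]. *)
Lemma contractive_gap (R : realType) (phi psi : R -> R) s :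
  altering phi -> right_Boyd_Wong psi -> 0 < s ->
  exists eta, [/\ 0 < eta, eta < s &
    forall t, s < t < s + eta -> psi t * phi (s + eta) < phi (s - eta)].
Proof.
move=> phiA psiBW s0.
have phis0 := altering_gt0 phiA s0.
have [c [d [/andP[c0 c1] d0 dP]]] := right_Boyd_Wong_near psiBW s0.
(* With k = (1 - c) phi(s) / 2, one has c (phi(s) + k) < phi(s) - k, because
   (1 + c) k < 2 k = (1 - c) phi(s). *)
have k0 : 0 < (1 - c) * phi s / 2 by rewrite !mulr_gt0 ?subr_gt0 ?invr_gt0.
have [d' d'0 d'P] := altering_continuous phiA (ltW s0) k0.
pose eta := Num.min d (Num.min d' s) / 2.
have m0 : 0 < Num.min d (Num.min d' s) by rewrite !lt_min d0 d'0.
have [etad [etad' etas]] : eta < d /\ eta < d' /\ eta < s.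
  have : Num.min d (Num.min d' s) <= Num.min d (Num.min d' s) by [].
  rewrite {2}/Num.min !le_min => /and3P [? ? ?]; rewrite /eta; split; lra.
exists eta; split=> // [|t /andP[st tseta]]; first by rewrite divr_gt0.
have eta0 : 0 < eta by rewrite divr_gt0.
have := d'P (s + eta).
have -> : s + eta - s = eta by lra.
rewrite gtr0_norm // => /(_ ltac:(lra) etad').
have := d'P (s - eta).
have -> : s - eta - s = - eta by lra.
rewrite normrN gtr0_norm // => /(_ ltac:(lra) etad').
rewrite !ltr_norml => /andP[lo _] /andP[_ hi].
have psic : psi t <= c by apply: dP; lra.
have : psi t * phi (s + eta) <= c * phi (s + eta).
  by rewrite ler_wpM2r // altering_ge0 //; lra.
nra.
Qed.

(** * Contractive maps *)

Section ContractiveMaps.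
Context {R : realType} {X : completeMetricType R}.
Context (phi psi : R -> R) (T : X -> X).
Context (phiA : altering phi) (psi_ge0 : nneg_fun psi).
Context (psi_lt1 : strictly_subunitary psi) (psiBW : right_Boyd_Wong psi).
Context (T_contr : contractive (@altered_dist R X phi) T psi).

Local Notation e := (@altered_dist R X phi).
Local Notation d := (@mdist R X).

Let e_ge0 x y : 0 <= e x y.
Proof. by rewrite altering_ge0 // mdist_ge0. Qed.

Let e_sym x y : e x y = e y x.
Proof. by rewrite /altered_dist metric_sym. Qed.

Let exx x : e x x = 0.
Proof. by rewrite /altered_dist mdistxx altering0. Qed.

Lemma e_gt0 x y : x <> y -> 0 < e x y.
Proof. by move=> /eqP xy; rewrite altering_gt0 // mdist_gt0. Qed.

Lemma M_le x y (m : R) : e x y <= m -> e x (T x) + e y (T y) <= 2 * m ->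
  (e x (T y) <= m) || (e (T x) y <= m) -> M e T x y <= m.
Proof.
move=> m1 m2 m3; rewrite /M !ge_max m1 ge_min m3 !andbT /M2; lra.
Qed.

(** Unlike the contractivity inequality, this one has no exception on the
    diagonal, so it applies to an orbit that meets its own limit. *)
Lemma contractive_leM x y : e (T x) (T y) <= M e T x y.
Proof.
have M0 : 0 <= M e T x y by rewrite /M !le_max e_ge0.
have [<-|/eqP xy] := eqVneq x y; first by rewrite exx // /M !le_max e_ge0.
apply: (le_trans (T_contr xy)); rewrite ler_piMl // ltW // psi_lt1 //.
by rewrite mdist_gt0; apply/eqP.
Qed.

Lemma contractive_subset1_Fix : is_subset1 (Fix T).
Proof.
move=> x y; rewrite /Fix /= => Tx Ty; apply: contrapT => xy.
have /T_contr : x <> y by [].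
have -> : M e T x y = e x y.
  apply/eqP; rewrite eq_le {2}/M !le_max lexx andbT; apply: M_le => //.
    by rewrite -Tx -Ty !exx addr0 mulr_ge0.
  by rewrite -Ty lexx.
rewrite -Tx -Ty leNgt gtr_pMl ?e_gt0 // psi_lt1 //.
by rewrite mdist_gt0; apply/eqP.
Qed.

(** Here [M3] vanishes, and [M2] can exceed [M1] only if
    [e (T x) (T (T x)) > e x (T x)]; but then [M] is at most
    [e (T x) (T (T x))], which [psi < 1] excludes.  So [M] is [e x (T x)]. *)
Lemma contractive_step x : x <> T x ->
  e (T x) (T (T x)) <= psi (d x (T x)) * e x (T x) < e x (T x).
Proof.
move=> xTx; have psi1 : psi (d x (T x)) < 1.
  by apply: psi_lt1; rewrite mdist_gt0; apply/eqP.
have ex0 := e_gt0 xTx; rewrite gtr_pMl // psi1 andbT.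
have psi0 : 0 <= psi (d x (T x)) by rewrite nneg_fun_ge0 // mdist_ge0.
have := T_contr xTx; have := e_ge0 (T x) (T (T x)).
have [lee|ltee] := leP (e (T x) (T (T x))) (e x (T x)).
  move=> _ /le_trans; apply; rewrite ler_wpM2l //; apply: M_le => //; first lra.
  by rewrite exx e_ge0 orbT.
move=> _ contr; exfalso.
have : M e T x (T x) <= e (T x) (T (T x)).
  apply: M_le; [exact: ltW | lra|].
  by rewrite exx e_ge0 orbT.
move=> Mle; have := le_trans contr (ler_wpM2l psi0 Mle).
rewrite leNgt gtr_pMl ?psi1 //; lra.
Qed.

Lemma contractive_dist_lt x : x <> T x -> d (T x) (T (T x)) < d x (T x).
Proof.
move=> /contractive_step /andP[step1 step2]; rewrite ltNge; apply/negP.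
move=> /(altering_le phiA (mdist_ge0 _ _)).
by rewrite leNgt (le_lt_trans step1).
Qed.

(** A positive limit of the distances would be approached strictly from the
    right, where the gap makes the next distance smaller than the limit. *)
Lemma contractive_regular x (r : R) : 0 < r ->
  exists N, forall n, (N <= n)%N -> d (iter n T x) (T (iter n T x)) < r.
Proof.
pose u n := d (iter n T x) (T (iter n T x)).
have u_le n : u n.+1 <= u n.
  rewrite /u iterS; have [E|/eqP] := eqVneq (iter n T x) (T (iter n T x)).
    by rewrite -!E.
  by move=> /contractive_dist_lt /ltW.
have u_noninc : nonincreasing_seq u by apply/nonincreasing_seqP.
have u_ge0 n : 0 <= u n by exact: mdist_ge0.
have u_cvg : cvgn u.
  by apply: nonincreasing_is_cvgn => //; exists 0 => _ [n _ <-].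
have lu : forall n, limn u <= u n by exact: nonincreasing_cvgn_ge.
have l_ge0 : 0 <= limn u by apply: limr_ge => //; near=> n.
suff l0 : limn u = 0.
  move=> r0; have /cvgrPdist_lt /(_ r r0) [N _ NP] := u_cvg.
  exists N => n Nn; have := NP n Nn.
  by rewrite l0 sub0r normrN ger0_norm.
apply/eqP; rewrite eq_le l_ge0 andbT leNgt; apply/negP => l_gt0.
have [eta [eta0 etal gap]] := contractive_gap phiA psiBW l_gt0.
have /cvgrPdist_lt /(_ eta eta0) [N _ /(_ N (leqnn N))] := u_cvg.
rewrite ltr_distlC => /andP[_ uN].
have neq : iter N T x <> T (iter N T x).
  by apply/eqP; rewrite -mdist_gt0 (lt_le_trans l_gt0) // lu.
have luN : limn u < u N.
  exact: le_lt_trans (lu N.+1) (contractive_dist_lt neq).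
have /gap : limn u < u N < limn u + eta by rewrite luN uN.
apply/negP; rewrite -leNgt.
have /andP[step _] := contractive_step neq.
apply: le_trans (le_trans step _).
  by apply: altering_le => //; [lra | have := lu N.+1; rewrite /u /=; lra].
apply: ler_wpM2l; last exact: altering_le (mdist_ge0 _ _) (ltW uN).
by rewrite nneg_fun_ge0 // mdist_ge0.
Unshelve. all: by end_near. Qed.

(** [T x] and [T y] are at distance at least [s - h], whereas all the
    distances entering [M] are at most [s + h]: the gap forbids this. *)
Lemma contractive_separation s : 0 < s ->
  exists2 eta, 0 < eta & forall x y,
    d x (T x) < eta -> d y (T y) < eta -> ~~ (s < d x y < s + eta).
Proof.
move=> s0.
have [h [h0 hs gap]] := contractive_gap phiA psiBW s0.
(* Moving both points by less than h / 2 changes their distance by less than h. *)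
exists (h / 2) => [|x y xTx yTy]; first by rewrite divr_gt0.
apply/negP => /andP[sxy xys].
have xy : x <> y by apply/eqP; rewrite -mdist_gt0; lra.
have /gap : s < d x y < s + h by lra.
apply/negP; rewrite -leNgt.
have Txy : s - h <= d (T x) (T y).
  have := metric_triangle x (T x) y; have := metric_triangle (T x) (T y) y.
  have := metric_sym y (T y); lra.
apply: le_trans (le_trans (T_contr xy) _).
  by apply: altering_le => //; lra.
apply: ler_wpM2l; first by rewrite nneg_fun_ge0 // mdist_ge0.
have le_phi a b : d a b <= s + h -> e a b <= phi (s + h).
  exact: altering_le (mdist_ge0 _ _).
apply: M_le.
- by apply: le_phi; lra.
- have := @le_phi x (T x) ltac:(lra); have := @le_phi y (T y) ltac:(lra); lra.
- by rewrite le_phi //; have := metric_triangle x y (T y); lra.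
Qed.

Lemma contractive_cvg x : cvgn (fun n => iter n T x).
Proof.
apply/cauchy_cvgP/cauchy_exP => r r0.
have s0 : 0 < r / 2 by rewrite divr_gt0.
have [eta eta0 sep] := contractive_separation s0.
have [N NP] := contractive_regular x eta0.
exists (iter N T x), N => // n /= Nn; rewrite ballEmdist /=.
suff : d (iter N T x) (iter n T x) <= r / 2 by lra.
(* The distance to the N-th iterate grows by less than eta at each step, so it
   cannot pass r / 2 without landing in the interval that separation forbids. *)
rewrite -(subnKC Nn); elim: (n - N)%N => [|k IHk].
  by rewrite addn0 mdistxx ltW.
rewrite leNgt; apply/negP => far.
have /negP := sep _ _ (NP N (leqnn N)) (NP (N + k.+1)%N (leq_addr _ _)).
apply; rewrite far addnS /=.
have := metric_triangle (iter N T x) (iter (N + k) T x) (T (iter (N + k) T x)).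
have := NP (N + k)%N (leq_addr _ _); lra.
Qed.

(** The factor 1/2 in [M2] is what makes this work: [M] at [(x_n, z)] tends to
    at most half of [e z (T z)], so [psi <= 1] suffices although the distances
    tend to [0], where [psi] need not be bounded away from [1]. *)
Lemma contractive_limit_Fix x z : (fun n => iter n T x) @ \oo --> z -> Fix T z.
Proof.
move=> xz; rewrite /Fix /=; apply: contrapT => zTz.
have b0 : 0 < d z (T z) by rewrite mdist_gt0; apply/eqP.
have phib0 : 0 < e z (T z) / 4 by rewrite divr_gt0 // e_gt0.
have [h h0 hP] := altering_continuous phiA (ltW b0) phib0.
have [h' h'0 h'P] := altering_continuous phiA (lexx 0) phib0.
have small a b : d a b < h' -> e a b < e z (T z) / 4.
  move=> abh'; have := h'P (d a b) (mdist_ge0 _ _).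
  rewrite subr0 altering0 // subr0 !ger0_norm ?mdist_ge0 //; first exact.
  exact: e_ge0.
have m0 : 0 < Num.min h h' by rewrite lt_min h0.
have [N1 N1P] := contractive_regular x h'0.
have /cvg_ballP /(_ _ m0) [N2 _ N2P] := xz.
pose n := maxn N1 N2; pose y := iter n T x.
have yTy : d y (T y) < h' by apply: N1P; rewrite leq_maxl.
have zy : d z y < Num.min h h'.
  by have := N2P n (leq_maxr _ _); rewrite ballEmdist.
have zTy : d z (T y) < Num.min h h'.
  by have := N2P n.+1 (leqW (leq_maxr _ _)); rewrite ballEmdist.
move: zy zTy; rewrite !lt_min => /andP[_ zy] /andP[zTyh zTyh'].
(* 5/8 = 1/2 (1/4 + 1) comes from M2; it is below the 3/4 that bounds
   e (T y) (T z) / e z (T z) from below. *)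
have MyzP : M e T y z <= 5 / 8 * e z (T z).
  apply: M_le.
  - by rewrite e_sym; have := small _ _ zy; lra.
  - by have := small _ _ yTy; lra.
  - by rewrite [e (T y) z]e_sym; have := small _ _ zTyh'; lra.
have : `|d (T y) (T z) - d z (T z)| < h.
  have := metric_triangle (T y) z (T z); have := metric_triangle z (T y) (T z).
  by rewrite (metric_sym (T y) z) ltr_norml; lra.
move=> /(hP _ (mdist_ge0 _ _)); rewrite ltr_norml => /andP[lo _].
have := le_trans (contractive_leM y z) MyzP.
by rewrite /altered_dist in phib0 lo *; lra.
Qed.

End ContractiveMaps.

Theorem theorem2 (R : realType) (X : completeMetricType R)
  (phi psi : R -> R) (T : X -> X) :
  altering phi ->
  nneg_fun psi ->
  strictly_subunitary psi ->
  right_Boyd_Wong psi ->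
  contractive (@altered_dist R X phi) T psi ->
  globally_strong_Picard T.
Proof.
move=> phiA psi_ge0 psi_lt1 psiBW T_contr.
split; last exact: contractive_subset1_Fix T_contr.
move=> x u; have u_cvg : cvgn u.
  exact: (contractive_cvg phiA psi_ge0 psi_lt1 psiBW T_contr).
split=> //.
exact: (contractive_limit_Fix phiA psi_ge0 psi_lt1 psiBW T_contr u_cvg).
Qed.
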